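(* Let $R\subset\mathbb{S}^d$ be a finite centrally symmetric set of unit vectors (i.e. $R=-R$). If all semi-stars of $R$ have the same norm, then $R$ is a root system.
   Context: $\mathbb{S}^d$ denotes the unit sphere in the Euclidean space $E=\mathbb{R}^{d+1}$, $d\ge1$. A semi-star of a finite centrally symmetric set $R\subset E\setminus\{0\}$ is a subset $S\subseteq R$ that contains exactly half the elements of $R$ and is the intersection of $R$ with a half-space; equivalently, $S=\{r\in R\mid\langle r,c\rangle>0\}$ for some $c\in E\setminus\{0\}$ that is non-orthogonal to every $r\in R$. The norm of a semi-star $S$ is the Euclidean norm $\big\|\sum_{r\in S}r\big\|$ of the sum of its elements. A root system is a finite set $R\subset E\setminus\{0\}$ with $T_rR=R$ for all $r\in R$, where $T_r=\mathrm{Id}-2rr^{\top}/\|r\|^2$ is the reflection on the hyperplane $r^\perp$ (no crystallographic or reducedness condition is required). *)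

(* Defs.v *)
From mathcomp Require Import all_boot all_order all_algebra.
From mathcomp Require Import finmap.
From mathcomp Require Import reals.

Set Implicit Arguments.
Unset Strict Implicit.
Unset Printing Implicit Defensive.

Import Order.TTheory GRing.Theory Num.Theory.

Local Open Scope fset_scope.
Local Open Scope ring_scope.

Section Definitions.
Variables (K : realType) (n : nat).
Implicit Types (u v r c : 'cV[K]_n) (R S : {fset 'cV[K]_n}).

Definition dot u v : K := (u^T *m v) 0 0.

(* The norm `|u| that MathComp-Analysis puts on matrices is the sup norm,
   hence this separate definition. *)
Definition enorm u : K := Num.sqrt (dot u u).

Definition refl_mx r : 'M[K]_n := 1%:M - (2 / enorm r ^+ 2) *: (r *m r^T).

Definition root_system R : Prop :=
  0 \notin R /\
  forall r, r \in R -> [fset refl_mx r *m x | x in R] = R.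

Definition centrally_symmetric R : Prop := [fset - r | r in R] = R.

Definition semi_star R S : Prop :=
  exists c, [/\ c != 0,
                forall r, r \in R -> dot r c != 0
              & S = [fset r in R | 0 < dot r c]].

Definition semi_star_norm S : K := enorm (\sum_(r <- S) r).

(* A half-space of E: open if b = false, closed if b = true. *)
Definition in_half_space (b : bool) c (t : K) r : bool := t < dot r c ?<= if b.

Lemma dotNl u v : dot (- u) v = - dot u v.
Proof. by rewrite /dot linearN mulNmx mxE. Qed.

(* Semi-stars are exactly the subsets cut out by a half-space that contain
   half of the elements. *)
Lemma semi_starP R S : centrally_symmetric R ->
  semi_star R S <->
  (#|` S| * 2 = #|` R|)%N /\
  exists b c t, c != 0 /\ S = [fset r in R | in_half_space b c t r].
Proof.
move=> symR.
have RN r : (- r \in R) = (r \in R).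
  have h x : x \in R -> - x \in R by move=> xR; rewrite -symR in_imfset.
  by apply/idP/idP => /h //; rewrite opprK.
pose N := [fset - r | r in S].
have NE r : (r \in N) = (- r \in S).
  apply/imfsetP/idP => [[x /= xS ->]|rS]; first by rewrite opprK.
  by exists (- r) => //; rewrite opprK.
have cN : #|` N| = #|` S| by rewrite card_imfset //; exact: oppr_inj.
have cUI := cardfsUI S N; rewrite {}cN addnn -muln2 in cUI.
split=> [[c [c0 oc SE]]|[hS [b [c [t [c0 SE]]]]]].
  have SEr r : (r \in S) = (r \in R) && (0 < dot r c) by rewrite SE !inE.
  split; last by exists false, c, 0; split.
  have I0 : S `&` N = fset0.
    apply/fsetP => r; rewrite !inE NE !SEr RN dotNl oppr_gt0.
    by case: (ltgtP 0 (dot r c)); rewrite ?andbF ?andbT.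
  have UR : S `|` N = R.
    apply/fsetP => r; rewrite !inE NE !SEr RN dotNl oppr_gt0 -andb_orr.
    have [rR|//] := boolP (r \in R).
    by have := oc _ rR; rewrite eq_sym neq_lt.
  by rewrite -cUI I0 UR cardfs0 addn0.
have SEr r : (r \in S) = (r \in R) && in_half_space b c t r.
  by rewrite SE !inE.
have up r s : r \in S -> s \in R -> s \notin S -> dot s c < dot r c.
  rewrite !SEr => /andP[_ rh] -> /=.
  move: rh; rewrite /in_half_space.
  case: b {SE SEr} => /= [rh|rh]; first by rewrite -ltNge => /lt_le_trans; exact.
  by rewrite -leNgt => /le_lt_trans; exact.
have SR r : r \in S -> r \in R by rewrite SEr => /andP[].
have UsubR : S `|` N `<=` R.
  by apply/fsubsetP => r; rewrite !inE NE => /orP[/SR//|/SR]; rewrite RN.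
have I0 : S `&` N = fset0.
  apply/eqP; apply/negPn/negP => /fset0Pn[r]; rewrite !inE NE => /andP[rS nrS].
  have UR : S `|` N = R.
    apply/eqP; rewrite eqEfsubset UsubR /=; apply/fsubsetP => x xR.
    rewrite !inE NE; apply/negPn/negP; rewrite negb_or => /andP[xS nxS].
    have nxR : - x \in R by rewrite RN.
    have := up _ _ rS xR xS; have := up _ _ nrS nxR nxS.
    by rewrite !dotNl ltrN2 => h /(lt_trans h); rewrite ltxx.
  move: cUI; rewrite UR hS -[RHS]addn0 => /addnI/eqP; rewrite cardfs_eq0.
  by move=> /eqP/fsetP/(_ r); rewrite !inE NE rS nrS.
have UR : S `|` N = R.
  apply/eqP; rewrite eqEfcard UsubR /= -hS -cUI I0 cardfs0 addn0.
  exact: leqnn.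
have pos r : r \in S -> 0 < dot r c.
  move=> rS; have nS : - r \notin S.
    apply/negP => nrS; move/fsetP: I0 => /(_ r).
    by rewrite !inE NE rS nrS.
  have nR : - r \in R by rewrite RN SR.
  by have := up _ _ rS nR nS; rewrite dotNl -subr_gt0 opprK -mulr2n pmulrn_lgt0.
exists c; split=> // [r rR|].
  move: rR; rewrite -{1}UR !inE NE => /orP[/pos/gt_eqF->//|/pos].
  by rewrite dotNl oppr_gt0 => /lt_eqF->.
apply/fsetP => r; rewrite !inE; apply/idP/andP => [rS|[rR r0]].
  by rewrite SR // pos.
move: rR; rewrite -{1}UR !inE NE => /orP[//|/pos].
by rewrite dotNl oppr_gt0 => /(lt_trans r0); rewrite ltxx.
Qed.

End Definitions.

(* Main.v *)
Require Import Defs.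
From mathcomp Require Import all_boot all_order all_algebra.
From mathcomp Require Import finmap.
From mathcomp Require Import reals.
From mathcomp Require Import ring lra.

(** Moving [c] across the hyperplane orthogonal to some [r] in [R] exchanges
    [r] and [- r] in the semi-star of [c].  Let [Q] be the sum of the elements
    on the positive side of a [c] that is orthogonal to [r] and [- r] only.
    Both [Q + r] and [Q - r] are sums of semi-stars, so equality of norms means
    that [Q] is orthogonal to [r] and that [Q] has the same norm for all such
    pairs ([wall_dot], [wall_norm]).

    The hypothesis passes to plane sections.  A reflection [T_r x] only concerns
    the plane [L] spanned by [r] and [x].  Choose [c0] orthogonal to [L] and to
    no element of [R] outside [L], and let [c] be a small perturbation of [c0],
    or of [- c0], inside [L].  The sum [Q] is then [q + A], or [q - A], where
    [q] comes from the elements in [L] and [A] does not depend on the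
    perturbation.  Comparing the two signs removes [A]: for each [r] in
    [L], the sum of the elements of [R] in [L] that lie in the open half-turn
    after [r] is orthogonal to [r] and has a norm [h] that is the same for all
    [r] ([plane_sum_dot], [plane_sum_norm]).

    Identify [L] with the complex numbers: that sum is [i h r].  If [z] is the
    first element met when turning counterclockwise from [u], the half-turns
    after [u] and after [z] differ only by losing [z] and gaining [- u], so
    [i h z = i h u - z - u], that is [z = w u] with [w = (h i - 1) / (h i + 1)].
    So each element has its successor at the same angle: the section consists of
    the vertices of a regular polygon, and it is stable under the reflections
    [T_r] ([refl_closed]). *)

Set Implicit Arguments.
Unset Strict Implicit.
Unset Printing Implicit Defensive.

Import Order.TTheory GRing.Theory Num.Theory.

Local Open Scope ring_scope.

Lemma seq_argmax (K : realDomainType) (T : eqType) (s : seq T) (p : pred T)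
    (f : T -> K) :
  has p s ->
  exists x, [/\ x \in s, p x & forall y, y \in s -> p y -> f y <= f x].
Proof.
elim: s => // a s IHs /=.
have [/IHs[x [xs px xmax]] _|/hasPn sNp] := boolP (has p s); last first.
  rewrite orbF => pa; exists a; split=> // [|y]; first exact: mem_head.
  by rewrite inE => /predU1P[->//|/sNp/negP].
have [/andP[pa xa]|nxa] := boolP (p a && (f x <= f a)).
  exists a; split=> // [|y]; first exact: mem_head.
  rewrite inE => /predU1P[->//|ys py].
  by rewrite (le_trans _ xa) // xmax.
exists x; split=> // [|y]; first by rewrite inE xs orbT.
rewrite inE => /predU1P[->pa|]; last exact: xmax.
by move: nxa; rewrite pa -ltNge => /ltW.
Qed.

(** * Plane geometry in coordinates *)

Section Plane.
Variable K : realFieldType.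
Implicit Types u v x y z r : (K * K)%type.

Definition inner u v : K := u.1 * v.1 + u.2 * v.2.

(** The determinant of [u] and [v]: for non-parallel vectors it is positive when
    [v] is reached from [u] by turning counterclockwise by less than a
    half-turn. *)
Definition cross u v : K := u.1 * v.2 - u.2 * v.1.

(** Multiplication by the complex number [a + i b]. *)
Definition turn (a b : K) u : K * K := (a * u.1 - b * u.2, b * u.1 + a * u.2).

(** The reflection in the line orthogonal to [r], for a unit vector [r]. *)
Definition refl r x : K * K :=
  (x.1 - 2 * inner x r * r.1, x.2 - 2 * inner x r * r.2).

Lemma crossNr u v : cross u (- v) = - cross u v.
Proof. by rewrite /cross /=; ring. Qed.

Lemma crossC u v : cross v u = - cross u v.
Proof. by rewrite /cross; ring. Qed.

Lemma crossuu u : cross u u = 0.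
Proof. by rewrite /cross; ring. Qed.

Lemma lagrange_identity u v :
  inner u u * inner v v = inner v u ^+ 2 + cross u v ^+ 2.
Proof. by rewrite /inner /cross; ring. Qed.

Lemma unit_decomp u v : inner u u = 1 ->
  v = turn (inner v u) (cross u v) u.
Proof.
move=> uu; rewrite [LHS]surjective_pairing /turn; congr (_, _).
  transitivity (v.1 * inner u u); first by rewrite uu mulr1.
  by rewrite /inner /cross; ring.
transitivity (v.2 * inner u u); first by rewrite uu mulr1.
by rewrite /inner /cross; ring.
Qed.

Lemma parallel_unit u v : inner u u = 1 -> inner v v = 1 -> cross u v = 0 ->
  v = u \/ v = - u.
Proof.
move=> uu vv uv; have := lagrange_identity u v;
  rewrite uu vv uv mulr1 expr0n addr0.
have := unit_decomp v uu; rewrite uv; move: (inner v u) => k {1 2}->.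
move=> /esym/eqP; rewrite sqrf_eq1 => /orP[]/eqP->; [left|right];
  by case: u {uu vv uv} => u1 u2; congr (_, _) => /=; ring.
Qed.

(** If [y] is passed on the way from [u] to [x], then it makes a smaller angle
    with [u] than [x] does.  Since [y - x] is the image of [y + x] under a
    quarter turn, up to a factor, this holds in either sense of rotation. *)
Lemma inner_lt_of_cross u y x : inner y y = 1 -> inner x x = 1 ->
  0 < cross y x * (cross u y + cross u x) -> inner u x < inner u y.
Proof.
move=> yy xx pos.
have E : (1 + inner x y) * (inner u y - inner u x) =
    cross y x * (cross u y + cross u x).
  transitivity (cross y x * (cross u y + cross u x)
      + inner u y * (1 - inner x x) - inner u x * (1 - inner y y)).
    by rewrite /inner /cross; ring.
  by rewrite xx yy subrr !mulr0 subr0 addr0.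
have P : 0 <= 1 + inner x y.
  suff -> : 1 + inner x y = inner (x + y) (x + y) / 2.
    by rewrite divr_ge0 // addr_ge0 // -expr2 sqr_ge0.
  transitivity ((inner x x + inner y y) / 2 + inner x y);
    first by rewrite xx yy; field.
  by rewrite /inner /=; field.
move: pos; rewrite -E -[inner u x < _]subr_gt0; apply: contraTT.
by rewrite -!leNgt; exact: mulr_ge0_le0.
Qed.

Lemma refl_self r : inner r r = 1 -> refl r r = - r.
Proof.
by move=> rr; rewrite /refl rr; case: (r) => r1 r2; congr (_, _) => /=; ring.
Qed.

Lemma refl_opp r : inner r r = 1 -> refl r (- r) = r.
Proof.
move=> rr; rewrite -[RHS]opprK -[X in _ = - X]refl_self //.
by rewrite /refl /inner /=; congr (_, _) => /=; ring.
Qed.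

(** A reflection conjugates each rotation to its inverse; written without the
    inverse. *)
Lemma refl_turn (a b : K) r y : a ^+ 2 + b ^+ 2 = 1 -> inner r r = 1 ->
  refl r y = turn a b (refl r (turn a b y)).
Proof.
move=> ab rr.
(* In this form the matrix of the reflection is visibly symmetric with trace
   zero, which is all that the computation below needs. *)
have reflE w : refl r w =
    ((r.2 ^+ 2 - r.1 ^+ 2) * w.1 - 2 * r.1 * r.2 * w.2,
     - (2 * r.1 * r.2) * w.1 - (r.2 ^+ 2 - r.1 ^+ 2) * w.2).
  rewrite /refl /=; congr (_, _).
    transitivity (w.1 * inner r r - 2 * inner w r * r.1).
      by rewrite rr mulr1.
    by rewrite /inner; ring.
  transitivity (w.2 * inner r r - 2 * inner w r * r.2).
    by rewrite rr mulr1.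
  by rewrite /inner; ring.
rewrite !reflE /turn /=; congr (_, _).
  set m := LHS; transitivity (m * (a ^+ 2 + b ^+ 2)).
    by rewrite ab mulr1.
  by rewrite /m; ring.
set m := LHS; transitivity (m * (a ^+ 2 + b ^+ 2)).
  by rewrite ab mulr1.
by rewrite /m; ring.
Qed.

(** * Planar sets with half-turn sums of constant norm *)

Section Cycle.
Variables (P : {fset K * K}) (h : K).
Hypothesis h_gt0 : 0 < h.
Hypothesis unitP : forall u, u \in P -> inner u u = 1.
Hypothesis oppP : forall u, u \in P -> - u \in P.
Hypothesis sumP : forall u, u \in P ->
  \sum_(v <- P | 0 < cross u v) v = turn 0 h u.

Definition no_between u z :=
  forall y, y \in P -> 0 < cross u y -> 0 < cross y z -> False.

(** The half-turn after [u] has a nonzero sum, hence is not empty, and its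
    element closest to [u] has nothing before it. *)
Lemma next_exists u : u \in P ->
  exists z, [/\ z \in P, 0 < cross u z & no_between u z].
Proof.
move=> uP.
have : has (fun v => 0 < cross u v) P.
  apply/negPn/negP => /hasPn none.
  have := sumP uP; rewrite big_seq_cond big1 => [|v /andP[/none/negPf->]] //.
  case=> /esym e1 /esym e2; have := unitP uP; rewrite /inner.
  have u2 : u.2 = 0.
    apply/eqP; move/eqP: e1.
    by rewrite mul0r sub0r oppr_eq0 mulf_eq0 gt_eqF.
  have u1 : u.1 = 0.
    by apply/eqP; move/eqP: e2; rewrite mul0r addr0 mulf_eq0 gt_eqF.
  by rewrite u1 u2 !mul0r addr0 => /esym/eqP; rewrite oner_eq0.
case/(seq_argmax (inner u)) => z [zP uz zmax]; exists z; split=> // y yP uy yz.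
have := inner_lt_of_cross (unitP yP) (unitP zP) (mulr_gt0 yz (addr_gt0 uy uz)).
by rewrite ltNge zmax.
Qed.

(** From [u] to its successor [z], the half-turn gains [- u] and loses [z]. *)
Lemma half_turn_step u z y : u \in P -> z \in P -> y \in P ->
  0 < cross u z -> no_between u z ->
  (0 < cross z y) && (y != - u) = (0 < cross u y) && (y != z).
Proof.
move=> uP zP yP uz nb; apply/andP/andP => -[].
  move=> zy yNu; have yz : y != z.
    by apply: contraTneq zy => ->; rewrite crossuu ltxx.
  split=> //; case: (ltgtP 0 (cross u y)) => // [uy|/esym uy].
    case: (nb (- y)); rewrite ?oppP // ?crossNr ?oppr_gt0 //.
    by rewrite crossC crossNr opprK.
  case: (parallel_unit (unitP uP) (unitP yP) uy) => yu.
    by move: zy; rewrite yu crossC oppr_gt0 ltNge ltW.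
  by rewrite yu eqxx in yNu.
move=> uy yz; split; last first.
  by apply: contraTneq uy => ->; rewrite crossNr crossuu oppr0 ltxx.
case: (ltgtP 0 (cross z y)) => // [zy|/esym zy].
  by case: (nb y) => //; rewrite crossC oppr_gt0.
case: (parallel_unit (unitP zP) (unitP yP) zy) => yE.
  by rewrite yE eqxx in yz.
by move: uy; rewrite yE crossNr oppr_gt0 ltNge ltW.
Qed.

(** Real and imaginary parts of [w = (h i - 1) / (h i + 1)]. *)
Let al := (h ^+ 2 - 1) / (h ^+ 2 + 1).
Let be := 2 * h / (h ^+ 2 + 1).

Let denom_neq0 : h ^+ 2 + 1 != 0.
Proof. by rewrite gt_eqF // ltr_wpDl // sqr_ge0. Qed.

Let al_be_unit : al ^+ 2 + be ^+ 2 = 1.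
Proof. by move: denom_neq0 => h1; rewrite /al /be; field. Qed.

(** Comparing the half-turn sums after [u] and after [z] gives
    [(h i + 1) z = (h i - 1) u]. *)
Lemma next_turn u z : u \in P -> z \in P -> 0 < cross u z ->
  no_between u z -> z = turn al be u.
Proof.
move=> uP zP uz nb.
have E : turn 0 h z = - u + (turn 0 h u - z).
  rewrite -(sumP uP) -(sumP zP).
  rewrite -[LHS]big_filter -[X in _ = _ + (X - _)]big_filter.
  rewrite (bigD1_seq (- u)) ?filter_uniq ?fset_uniq //=; last first.
    by rewrite mem_filter oppP // crossNr crossC opprK uz.
  rewrite [in RHS](bigD1_seq z) ?filter_uniq ?fset_uniq //=; last first.
    by rewrite mem_filter zP uz.
  rewrite [z + _]addrC addrK !big_filter_cond; congr (_ + _).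
  rewrite big_seq_cond [in RHS]big_seq_cond; apply: eq_bigl => y.
  by have [yP|//] := boolP (y \in P); rewrite (half_turn_step uP zP).
move: denom_neq0 => h1.
(* Coordinates of (h i + 1) z = (h i - 1) u, solved for z. *)
move: E {uz nb zP uP}; case: u z => [u1 u2] [z1 z2]; rewrite /turn /=.
case=> e1 e2.
have f1 : z1 - h * z2 = - u1 - h * u2.
  transitivity (z1 + (0 * z1 - h * z2)); first by ring.
  by rewrite e1; ring.
have f2 : h * z1 + z2 = h * u1 - u2.
  transitivity (z2 + (h * z1 + 0 * z2)); first by ring.
  by rewrite e2; ring.
congr (_, _).
  transitivity ((z1 - h * z2 + h * (h * z1 + z2)) / (h ^+ 2 + 1)).
    by field.
  by rewrite f1 f2 /al /be; field.
transitivity ((h * z1 + z2 - h * (z1 - h * z2)) / (h ^+ 2 + 1)); first by field.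
by rewrite f1 f2 /al /be; field.
Qed.

Lemma turn_mem u : u \in P ->
  [/\ turn al be u \in P, 0 < cross u (turn al be u)
    & no_between u (turn al be u)].
Proof.
by move=> uP; have [z [zP uz nb]] := next_exists uP; rewrite -(next_turn uP zP).
Qed.

Lemma turn_inj : injective (turn al be).
Proof.
move: denom_neq0 => h1.
apply: (can_inj (g := turn al (- be))) => -[u1 u2]; rewrite /turn /=.
by congr (_, _); rewrite /al /be; field.
Qed.

Lemma turn_surj x : x \in P -> exists2 w, w \in P & x = turn al be w.
Proof.
move=> xP.
have sub : ([fset turn al be u | u in P] `<=` P)%fset.
  by apply/fsubsetP => y /imfsetP[u /= uP ->]; case: (turn_mem uP).
have : [fset turn al be u | u in P]%fset == P.
  rewrite eqEfcard sub card_imfset /=; [exact: leqnn|exact: turn_inj].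
by move/eqP/fsetP/(_ x); rewrite xP => /imfsetP[w /= wP ->]; exists w.
Qed.

(** The elements of [P] whose mirror image is missing from [P] form a set
    stable under multiplication by [w] and by its inverse.  If it is not empty,
    take its element [x] closest to [r].  One step from [x] towards [r] cannot
    jump over [r], since consecutive elements of [P] have nothing between them,
    so it ends closer to [r], a contradiction. *)
Lemma refl_closed r x : r \in P -> x \in P -> refl r x \in P.
Proof.
move=> rP xP; apply/negPn/negP => bad.
have rr := unitP rP.
have : has (fun x => refl r x \notin P) P by apply/hasP; exists x.
case/(seq_argmax (inner r)) => {xP bad}x [xP bad xmax].
have crossN y : refl r y \notin P -> y \in P -> cross r y != 0.
  move=> ny yP; apply: contraNneq ny => ry.
  case: (parallel_unit rr (unitP yP) ry) => ->.
    by rewrite refl_self ?oppP.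
  by rewrite refl_opp.
have closer y : y \in P -> refl r y \notin P -> inner r x < inner r y -> False.
  by move=> yP ny; rewrite ltNge xmax.
(* The step towards r is multiplication by w if r lies counterclockwise from x,
   and by its inverse otherwise. *)
have := crossN x bad xP; rewrite neq_lt => /orP[rx|rx].
  have [yP xy nb] := turn_mem xP; set y := turn al be x in yP xy nb.
  have ny : refl r y \notin P.
    apply: contraNN bad => yP'; rewrite (refl_turn _ al_be_unit rr).
    by case: (turn_mem yP').
  apply: (closer y yP ny).
  have := crossN y ny yP; rewrite neq_lt => /orP[ry|ry]; last first.
    by case: (nb r rP) => //; rewrite crossC oppr_gt0.
  apply: (inner_lt_of_cross (unitP yP) (unitP xP)).
  by rewrite nmulr_rgt0 ?(crossC x y) ?oppr_lt0 //; lra.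
have [y yP xE] := turn_surj xP.
have [_ yx nb] := turn_mem yP; rewrite -xE in yx nb.
have ny : refl r y \notin P.
  apply: contraNN bad => /turn_surj[w wP].
  rewrite (refl_turn _ al_be_unit rr) -xE.
  by move/turn_inj => ->.
apply: (closer y yP ny).
have := crossN y ny yP; rewrite neq_lt => /orP[ry|ry].
  by case: (nb r rP) => //; rewrite crossC oppr_gt0.
apply: (inner_lt_of_cross (unitP yP) (unitP xP)).
by rewrite mulr_gt0 // addr_gt0.
Qed.

End Cycle.
End Plane.

(** * The inner product and generic perturbations *)

Section Ambient.
Variables (K : realType) (n : nat).
Implicit Types (u v r c y : 'cV[K]_n) (R S : {fset 'cV[K]_n}).

Lemma dotC u v : dot u v = dot v u.
Proof. by rewrite /dot !mxE; apply: eq_bigr => i _; rewrite !mxE mulrC. Qed.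

Lemma dotDr u v w : dot u (v + w) = dot u v + dot u w.
Proof. by rewrite /dot mulmxDr mxE. Qed.

Lemma dotDl u v w : dot (v + w) u = dot v u + dot w u.
Proof. by rewrite !(dotC _ u) dotDr. Qed.

Lemma dotZr a u v : dot u (a *: v) = a * dot u v.
Proof. by rewrite /dot -scalemxAr mxE. Qed.

Lemma dotZl a u v : dot (a *: u) v = a * dot u v.
Proof. by rewrite dotC dotZr dotC. Qed.

Lemma dotNr u v : dot u (- v) = - dot u v.
Proof. by rewrite dotC dotNl dotC. Qed.

Lemma dot0l u : dot 0 u = 0.
Proof. by rewrite /dot trmx0 mul0mx mxE. Qed.

Lemma dot_suml I (s : seq I) (p : pred I) (F : I -> 'cV[K]_n) v :
  dot (\sum_(i <- s | p i) F i) v = \sum_(i <- s | p i) dot (F i) v.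
Proof.
by apply: (big_morph (fun u => dot u v)) => [x y|]; rewrite ?dotDl ?dot0l.
Qed.

Lemma dot_ge0 u : 0 <= dot u u.
Proof. by rewrite /dot mxE sumr_ge0 // => i _; rewrite mxE -expr2 sqr_ge0. Qed.

Lemma dot_eq0 u : dot u u = 0 -> u = 0.
Proof.
move=> /eqP; rewrite /dot mxE psumr_eq0; last first.
  by move=> i _; rewrite mxE -expr2 sqr_ge0.
move=> /allP h; apply/matrixP => i j; rewrite mxE ord1.
by have := h i (mem_index_enum _); rewrite mxE mulf_eq0 orbb => /eqP.
Qed.

Lemma enorm_sqr u : enorm u ^+ 2 = dot u u.
Proof. by rewrite sqr_sqrtr // dot_ge0. Qed.

Lemma mul_refl_mx r x : enorm r = 1 -> refl_mx r *m x = x - (2 * dot x r) *: r.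
Proof.
move=> r1; rewrite /refl_mx r1 expr1n divr1 mulmxBl mul1mx -scalemxAl -mulmxA.
rewrite [r^T *m x]mx11_scalar -/(dot r x) mul_mx_scalar scalerA dotC.
by [].
Qed.

(** For small [eps] the signs of the products with [c + eps *: c'] are the
    lexicographic signs: [c] decides, and [c'] breaks ties. *)
Lemma lex_perturb (s : seq 'cV[K]_n) c c' :
  exists eps : K, forall y, y \in s ->
    (dot y (c + eps *: c') == 0) = (dot y c == 0) && (dot y c' == 0) /\
    (0 < dot y (c + eps *: c')) =
      (0 < dot y c) || (dot y c == 0) && (0 < dot y c').
Proof.
suff [eps [e0 H]] : exists eps : K, 0 < eps /\
    forall y, y \in s -> dot y c != 0 -> eps * `|dot y c'| < `|dot y c|.
  exists eps => y /H{}H; rewrite dotDr dotZr.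
  have [y0|y0] := eqVneq (dot y c) 0.
    by rewrite y0 add0r mulf_eq0 gt_eqF // pmulr_rgt0 // ltxx.
  have {H} : `|eps * dot y c'| < `|dot y c| by rewrite normrM gtr0_norm ?H.
  move: (eps * _) => b; rewrite orbF /=.
  move: y0; rewrite neq_lt => /orP[a0|a0].
    rewrite (ltr0_norm a0) ltr_norml opprK => /andP[_ b1].
    have h : dot y c + b < 0 by lra.
    by rewrite lt_eqF // !ltNge !ltW.
  rewrite (gtr0_norm a0) ltr_norml => /andP[b1 _].
  have h : 0 < dot y c + b by lra.
  by rewrite gt_eqF // h a0.
elim: s => [|z s [eps [e0 H]]]; first by exists 1.
pose d := `|dot z c| / (1 + `|dot z c'|).
have D0 : 0 < 1 + `|dot z c'| by rewrite ltr_wpDr.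
have [z0|z0] := eqVneq (dot z c) 0.
  exists eps; split=> // y; rewrite inE => /predU1P[->|ys]; last exact: H.
  by rewrite z0 eqxx.
have d0 : 0 < d by rewrite divr_gt0 // normr_gt0.
exists (Num.min eps d); split; first by rewrite lt_min e0.
move=> y; rewrite inE => /predU1P[->|ys] y0; last first.
  apply: le_lt_trans (H y ys y0).
  by rewrite ler_wpM2r // ge_min lexx.
apply: le_lt_trans (_ : d * `|dot z c'| < _).
  by rewrite ler_wpM2r // ge_min lexx orbT.
rewrite /d mulrAC ltr_pdivrMr // ltr_pM2l ?normr_gt0 //; lra.
Qed.

(** Some normal vector of the plane spanned by [e1] and [e2] is orthogonal to
    no element of [s] outside this plane: the components [w] of those elements
    orthogonal to the plane are added one by one with small coefficients. *)
Lemma generic_normal (s : seq 'cV[K]_n) e1 e2 :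
  dot e1 e1 = 1 -> dot e2 e2 = 1 -> dot e1 e2 = 0 ->
  exists c, [/\ dot e1 c = 0, dot e2 c = 0 & forall y, y \in s ->
     dot y c = 0 -> y = dot y e1 *: e1 + dot y e2 *: e2].
Proof.
move=> e11 e22 e12; elim: s => [|z s [c [c1 c2 H]]].
  by exists 0; split=> //; rewrite dotC dot0l.
pose w := z - (dot z e1 *: e1 + dot z e2 *: e2).
have we1 : dot e1 w = 0.
  rewrite /w dotDr dotNr dotDr !dotZr e11 e12 (dotC e1 z); ring.
have we2 : dot e2 w = 0.
  rewrite /w dotDr dotNr dotDr !dotZr e22 (dotC e2 e1) e12 (dotC e2 z); ring.
have [eps He] := lex_perturb (z :: s) c w.
exists (c + eps *: w); split.
- by rewrite dotDr dotZr we1 c1 mulr0 addr0.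
- by rewrite dotDr dotZr we2 c2 mulr0 addr0.
move=> y ys /eqP; have [-> _] := He y ys; case/andP => /eqP yc /eqP yw.
move: ys; rewrite inE => /predU1P[yz|ys]; last exact: H.
rewrite {y yc}yz in yw *.
apply/eqP; rewrite -subr_eq0; apply/eqP/dot_eq0.
rewrite -/w {1}/w dotDl dotNl dotDl !dotZl we1 we2 yw; ring.
Qed.

(** * Crossing one hyperplane *)

Section EqualNorms.
Variable R : {fset 'cV[K]_n}.
Hypothesis unitR : forall r, r \in R -> enorm r = 1.
Hypothesis symR : centrally_symmetric R.
Hypothesis normR : forall S T : {fset 'cV[K]_n}, semi_star R S ->
  semi_star R T -> semi_star_norm S = semi_star_norm T.

Lemma dot_unit r : r \in R -> dot r r = 1.
Proof. by move=> /unitR r1; rewrite -enorm_sqr r1 expr1n. Qed.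

Lemma opp_mem r : r \in R -> - r \in R.
Proof. by move=> rR; rewrite -symR in_imfset. Qed.

Definition pos_sum c := \sum_(y <- R | 0 < dot y c) y.

(** [c] lies in the relative interior of a facet, orthogonal to [r], of a
    chamber of the hyperplane arrangement dual to [R]. *)
Definition on_wall r c := [/\ r \in R, dot r c = 0 &
  forall y, y \in R -> dot y c = 0 -> y = r \/ y = - r].

Lemma on_wallN r c : on_wall r c -> on_wall (- r) c.
Proof.
case=> rR rc H; split; rewrite ?opp_mem ?dotNl ?rc ?oppr0 // => y yR yc.
by case: (H y yR yc) => ->; rewrite ?opprK; auto.
Qed.

(** Pushing [c] off the wall towards [r] adds just [r] to the positive side. *)
Lemma wall_semi_star r c : on_wall r c ->
  exists S, semi_star R S /\ \sum_(y <- S) y = r + pos_sum c.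
Proof.
case=> rR rc H; have [eps He] := lex_perturb R c r.
have rr := dot_unit rR.
have [r1 r2] := He r rR; move: r1 r2.
rewrite rc rr oner_eq0 eqxx ltr01 ltxx /= => r1 r2.
exists [fset y in R | 0 < dot y (c + eps *: r)]%fset; split.
  exists (c + eps *: r); split=> // [|y yR].
    by apply: contraFneq r1 => ->; rewrite dotC dot0l.
  have [-> _] := He y yR; apply/negP => /andP[/eqP yc].
  by case: (H y yR yc) => ->; rewrite ?dotNl rr ?oppr_eq0 oner_eq0.
rewrite big_fset /= -[LHS]big_filter.
rewrite (bigD1_seq r) ?filter_uniq ?fset_uniq //=; last first.
  by rewrite mem_filter r2 rR.
congr (_ + _); rewrite big_filter_cond big_seq_cond /pos_sum [RHS]big_seq_cond.
apply: eq_bigl => y; have [yR|//] := boolP (y \in R); have [_ -> /=] := He y yR.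
have [yc|yc] := eqVneq (dot y c) 0.
  case: (H y yR yc) => ->; first by rewrite eqxx andbF rc ltxx.
  by rewrite dotNl rc oppr0 ltxx /= dotNl rr oppr_gt0 ltr10.
rewrite orbF; case: (0 < dot y c) => //=.
by apply: contraNneq yc => ->; rewrite rc.
Qed.

Lemma semi_star_sum_dot S T : semi_star R S -> semi_star R T ->
  dot (\sum_(y <- S) y) (\sum_(y <- S) y) =
    dot (\sum_(y <- T) y) (\sum_(y <- T) y).
Proof. by move=> sS sT; rewrite -!enorm_sqr; congr (_ ^+ 2); apply: normR. Qed.

(** The sums [r + Q] and [- r + Q] of the semi-stars on the two sides of the
    wall have the same norm. *)
Lemma wall_dot r c : on_wall r c -> dot (pos_sum c) r = 0.
Proof.
move=> w; have [S [sS SE]] := wall_semi_star w.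
have [T [sT TE]] := wall_semi_star (on_wallN w).
have := semi_star_sum_dot sS sT.
rewrite SE TE !(dotDl, dotDr, dotNl, dotNr) opprK (dotC r (pos_sum c)); lra.
Qed.

Lemma wall_norm r c r' c' : on_wall r c -> on_wall r' c' ->
  dot (pos_sum c) (pos_sum c) = dot (pos_sum c') (pos_sum c').
Proof.
move=> w w'; have [S [sS SE]] := wall_semi_star w.
have [T [sT TE]] := wall_semi_star w'.
have := semi_star_sum_dot sS sT; rewrite SE TE !(dotDl, dotDr, dotNl, dotNr).
have [rR _ _] := w; have [r'R _ _] := w'.
rewrite (dotC r (pos_sum _)) (dotC r' (pos_sum _)) (wall_dot w) (wall_dot w').
by rewrite (dot_unit rR) (dot_unit r'R) !addr0 !add0r => /addrI.
Qed.

Lemma pos_sumN c : pos_sum (- c) = - pos_sum c.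
Proof.
rewrite /pos_sum -[in LHS]symR big_mkcond big_imfset /=; last first.
  by move=> ? ? _ _; exact: oppr_inj.
rewrite -big_mkcond sumrN; congr (- _); apply: eq_bigl => y.
by rewrite dotNl dotNr opprK.
Qed.

Lemma pos_sum_perturb c j : exists eps : K,
  pos_sum (c + eps *: j) =
    pos_sum c + \sum_(y <- R | (dot y c == 0) && (0 < dot y j)) y /\
  forall y, y \in R ->
    (dot y (c + eps *: j) == 0) = (dot y c == 0) && (dot y j == 0).
Proof.
have [eps He] := lex_perturb R c j; exists eps; split; last first.
  by move=> y /He[].
rewrite /pos_sum big_mkcond /= [in RHS]big_mkcond /=.
rewrite [X in _ = _ + X]big_mkcond /= -big_split /=.
rewrite big_seq [in RHS]big_seq; apply: eq_bigr => y /He[_ ->].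
have [->|_] := eqVneq (dot y c) 0; first by rewrite ltxx add0r.
by rewrite orbF addr0.
Qed.

(** * Restriction to a plane *)

Definition coords (e1 e2 y : 'cV[K]_n) : K * K := (dot y e1, dot y e2).

Lemma coordsN e1 e2 y : coords e1 e2 (- y) = - coords e1 e2 y.
Proof. by rewrite /coords !dotNl. Qed.

Lemma coords_sum e1 e2 I (s : seq I) (p : pred I) (F : I -> 'cV[K]_n) :
  coords e1 e2 (\sum_(i <- s | p i) F i) =
    \sum_(i <- s | p i) coords e1 e2 (F i).
Proof.
apply: (big_morph (coords e1 e2)) => [u v|]; last by rewrite /coords !dot0l.
by rewrite /coords !dotDl.
Qed.

(* The vector c0 stands for a normal vector of the plane with orthonormal basis
   e1, e2 that is orthogonal to no element of R outside this plane. *)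
Section Localize.
Variables e1 e2 c0 : 'cV[K]_n.
Hypothesis in_plane : forall y, y \in R ->
  dot y c0 = 0 -> y = dot y e1 *: e1 + dot y e2 *: e2.

Notation f := (coords e1 e2).

(** The quarter turn of the orthogonal projection of [r] to the plane. *)
Definition normal r := dot r e1 *: e2 - dot r e2 *: e1.

Lemma dot_normal r y : dot y (normal r) = cross (f r) (f y).
Proof. by rewrite /normal dotDr dotNr !dotZr /cross /=; ring. Qed.

Lemma dot_coords y z : z = dot z e1 *: e1 + dot z e2 *: e2 ->
  dot y z = inner (f y) (f z).
Proof. by move=> {1}->; rewrite dotDr !dotZr /inner /=; ring. Qed.

Lemma coords_unit y : y \in R -> dot y c0 = 0 -> inner (f y) (f y) = 1.
Proof.
by move=> yR yc; rewrite -dot_coords ?dot_unit //; exact: in_plane.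
Qed.

Definition plane_sum r :=
  \sum_(y <- R | (dot y c0 == 0) && (0 < cross (f r) (f y))) y.

Lemma plane_sum_in r :
  plane_sum r = dot (plane_sum r) e1 *: e1 + dot (plane_sum r) e2 *: e2.
Proof.
rewrite !dot_suml !scaler_suml -big_split /plane_sum.
rewrite big_seq_cond [RHS]big_seq_cond /=.
by apply: eq_bigr => y /and3P[yR /eqP yc _]; exact: in_plane.
Qed.

(** The two vectors are small perturbations of [c0] and of [- c0] in the
    direction [normal r]. *)
Lemma local_walls r : r \in R -> dot r c0 = 0 -> exists c c',
  [/\ on_wall r c, on_wall r c', pos_sum c = plane_sum r + pos_sum c0
     & pos_sum c' = plane_sum r - pos_sum c0].
Proof.
move=> rR rc0.
have W (b : K) eps : b != 0 ->
   (forall y, y \in R -> (dot y (b *: c0 + eps *: normal r) == 0) =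
     (dot y (b *: c0) == 0) && (dot y (normal r) == 0)) ->
   on_wall r (b *: c0 + eps *: normal r).
  move=> b0 H; split=> // [|y yR /eqP].
    by apply/eqP; rewrite H // dotZr rc0 mulr0 dot_normal crossuu eqxx.
  rewrite H // dotZr mulf_eq0 (negPf b0) /= dot_normal.
  case/andP=> /eqP yc0 /eqP yr.
  rewrite (in_plane yR yc0) (in_plane rR rc0).
  have := parallel_unit (coords_unit rR rc0) (coords_unit yR yc0) yr.
  by case=> -[-> ->]; [left|right]; rewrite ?scaleNr ?opprD.
have [eps [Q H]] := pos_sum_perturb (1 *: c0) (normal r).
have [eps' [Q' H']] := pos_sum_perturb (- 1 *: c0) (normal r).
exists (1 *: c0 + eps *: normal r), (- 1 *: c0 + eps' *: normal r); split.
- by apply: W => //; exact: oner_neq0.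
- by apply: W => //; rewrite oppr_eq0 oner_neq0.
- rewrite Q addrC scale1r; congr (_ + _); apply: eq_bigl => y.
  by rewrite dot_normal.
- rewrite Q' addrC scaleN1r pos_sumN; congr (_ + _).
  by apply: eq_bigl => y; rewrite dotNr oppr_eq0 dot_normal.
Qed.

Lemma plane_sum_dot r : r \in R -> dot r c0 = 0 -> dot (plane_sum r) r = 0.
Proof.
move=> rR rc0; have [c [c' [w w' E E']]] := local_walls rR rc0.
have := wall_dot w; have := wall_dot w'; rewrite E E' !dotDl !dotNl; lra.
Qed.

(** By the parallelogram law, the common norm of [plane_sum r + pos_sum c0] and
    [plane_sum r - pos_sum c0] determines that of [plane_sum r]. *)
Lemma plane_sum_norm r s :
  r \in R -> dot r c0 = 0 -> s \in R -> dot s c0 = 0 ->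
  dot (plane_sum r) (plane_sum r) = dot (plane_sum s) (plane_sum s).
Proof.
move=> rR rc0 sR sc0; have [c [c' [w w' E E']]] := local_walls rR rc0.
have [b [b' [v v' F F']]] := local_walls sR sc0.
have := wall_norm w w'; have := wall_norm w v; have := wall_norm w v'.
rewrite E E' F F' !(dotDl, dotDr, dotNl, dotNr).
rewrite !(dotC (pos_sum _) (plane_sum _)); lra.
Qed.

Lemma coords_inj y z : y \in R -> dot y c0 = 0 -> z \in R -> dot z c0 = 0 ->
  f y = f z -> y = z.
Proof.
move=> yR yc zR zc [E1 E2].
by rewrite (in_plane yR yc) (in_plane zR zc) E1 E2.
Qed.

Lemma cross_plane_sum r : cross (f r) (f (plane_sum r)) =
  \sum_(y <- R | (dot y c0 == 0) && (0 < cross (f r) (f y))) cross (f r) (f y).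
Proof.
by rewrite -dot_normal dot_suml; apply: eq_bigr => y _; exact: dot_normal.
Qed.

Lemma cross_plane_sum_ge0 r : 0 <= cross (f r) (f (plane_sum r)).
Proof. by rewrite cross_plane_sum sumr_ge0 // => y /andP[_ /ltW]. Qed.

Lemma cross_plane_sum_gt0 r x : x \in R -> dot x c0 = 0 ->
  cross (f r) (f x) != 0 -> 0 < cross (f r) (f (plane_sum r)).
Proof.
move=> xR xc rx.
have [y [yR yc ry]] :
    exists y, [/\ y \in R, dot y c0 = 0 & 0 < cross (f r) (f y)].
  move: rx; rewrite neq_lt => /orP[rx|rx]; last by exists x.
  by exists (- x); rewrite opp_mem // dotNl xc oppr0 coordsN crossNr oppr_gt0.
rewrite cross_plane_sum -[ltRHS]big_filter.
rewrite (bigD1_seq y) ?filter_uniq ?fset_uniq //=; last first.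
  by rewrite mem_filter yR yc eqxx ry.
by rewrite ltr_pwDl // big_filter_cond sumr_ge0 // => z /andP[/andP[_ /ltW]].
Qed.

Lemma cross_plane_sum_sqr r : r \in R -> dot r c0 = 0 ->
  cross (f r) (f (plane_sum r)) ^+ 2 = dot (plane_sum r) (plane_sum r).
Proof.
move=> rR rc; have := lagrange_identity (f r) (f (plane_sum r)).
rewrite coords_unit // -!dot_coords ?plane_sum_dot //; last first.
- exact: plane_sum_in.
- exact: in_plane.
by rewrite mul1r expr0n add0r.
Qed.

(** All half-turn sums are obtained by one and the same similarity of ratio
    [h = cross (f r) (f (plane_sum r))], since they are orthogonal to their
    starting vectors, on the same side, and have equal norms. *)
Lemma plane_sum_turn r s :
  r \in R -> dot r c0 = 0 -> s \in R -> dot s c0 = 0 ->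
  f (plane_sum s) = turn 0 (cross (f r) (f (plane_sum r))) (f s).
Proof.
move=> rR rc sR sc.
have <- : cross (f s) (f (plane_sum s)) = cross (f r) (f (plane_sum r)).
  apply/eqP; rewrite -(eqrXn2 (n := 2)) ?cross_plane_sum_ge0 //.
  by rewrite !cross_plane_sum_sqr // (plane_sum_norm sR sc rR rc).
rewrite {1}(unit_decomp (f (plane_sum s)) (coords_unit sR sc)).
by rewrite -dot_coords ?plane_sum_dot //; exact: in_plane.
Qed.

(** A vector [x] that is not parallel to [r] makes the ratio [h] of
    [plane_sum_turn] positive, and then the coordinate vectors form a planar set
    with half-turn sums of constant norm. *)
Lemma plane_refl r x : r \in R -> dot r c0 = 0 -> x \in R -> dot x c0 = 0 ->
  cross (f r) (f x) != 0 -> x - (2 * dot x r) *: r \in R.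
Proof.
move=> rR rc0 xR xc0 rx.
pose P := [fset f y | y in R & dot y c0 == 0]%fset.
have PP (p : K * K) :
    reflect (exists y, [/\ y \in R, dot y c0 = 0 & p = f y]) (p \in P).
  apply: (iffP idP) => [/imfsetP[y /=]|[y [yR /eqP yc ->]]].
    by rewrite !inE => /andP[yR /eqP yc] ->; exists y.
  by apply/imfsetP; exists y; rewrite //= !inE yR.
have : refl (f r) (f x) \in P.
  apply: (refl_closed (cross_plane_sum_gt0 xR xc0 rx)).
  - by move=> u /PP[y [yR yc ->]]; exact: coords_unit.
  - move=> u /PP[y [yR yc ->]]; apply/PP; exists (- y).
    by rewrite opp_mem // dotNl yc oppr0 coordsN.
  - move=> u /PP[y [yR yc ->]]; rewrite -(plane_sum_turn rR rc0) //.
    rewrite coords_sum big_mkcond big_imfset /=; last first.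
      move=> z1 z2 /andP[z1R /eqP z1c] /andP[z2R /eqP z2c].
      exact: coords_inj.
    by rewrite -big_mkcond big_filter_cond.
  - by apply/PP; exists r.
  - by apply/PP; exists x.
case/PP=> y [yR yc yE]; suff <- : y = x - (2 * dot x r) *: r by [].
rewrite (in_plane yR yc); move: yE => [<- <-].
rewrite -dot_coords; last exact: in_plane.
transitivity (dot x e1 *: e1 + dot x e2 *: e2
    - (2 * dot x r) *: (dot r e1 *: e1 + dot r e2 *: e2)).
  by rewrite !scalerBl scalerDr !scalerA opprD addrACA.
by rewrite -!in_plane.
Qed.

End Localize.

Lemma refl_mem r x : r \in R -> x \in R -> x - (2 * dot x r) *: r \in R.
Proof.
move=> rR xR; have rr := dot_unit rR; have xx := dot_unit xR.
pose w := x - dot x r *: r.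
have rw : dot r w = 0 by rewrite /w dotDr dotNr dotZr rr (dotC r x) mulr1 subrr.
have xE : x = dot x r *: r + w by rewrite /w addrC subrK.
have [w0|w0] := eqVneq w 0.
  (* Here x = r or x = - r, and the reflection maps x to - x. *)
  suff -> : x - (2 * dot x r) *: r = - x by exact: opp_mem.
  rewrite [x in x - _]xE [in RHS]xE w0 addr0 -scalerBl -scaleNr.
  by congr (_ *: _); ring.
have ww : 0 < dot w w.
  rewrite lt_neqAle dot_ge0 andbT eq_sym.
  by apply: contra_neq w0; exact: dot_eq0.
have nw : enorm w != 0 by rewrite sqrtr_eq0 -ltNge.
(* Gram-Schmidt: r and e2 form an orthonormal basis of the plane of r and x. *)
pose e2 := (enorm w)^-1 *: w.
have e22 : dot e2 e2 = 1.
  by rewrite /e2 dotZl dotZr -enorm_sqr; field.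
have e12 : dot r e2 = 0 by rewrite /e2 dotZr rw mulr0.
have [c [c1 c2 H]] := generic_normal R rr e22 e12.
have wc : w = enorm w *: e2 by rewrite /e2 scalerA mulfV // scale1r.
have xc : dot x c = 0.
  by rewrite xE dotDl dotZl c1 wc dotZl c2 !mulr0 addr0.
apply: (plane_refl H) => //.
rewrite /cross /coords /= rr e12 mul0r subr0 mul1r.
by rewrite xE dotDl dotZl e12 mulr0 add0r wc dotZl e22 mulr1.
Qed.

Lemma equal_norms_root_system : root_system R.
Proof.
split.
  apply/negP => /dot_unit; rewrite dot0l => /esym/eqP.
  by rewrite oner_eq0.
move=> r rR; have mulE x := mul_refl_mx x (unitR rR).
apply/fsetP => y; apply/imfsetP/idP => [[x /= xR ->]|yR].
  by rewrite mulE refl_mem.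
exists (y - (2 * dot y r) *: r); first exact: refl_mem.
rewrite mulE dotDl dotNl dotZl (dot_unit rR) -addrA -opprD -scalerDl.
rewrite -[LHS]subr0; congr (_ - _).
by rewrite -(scale0r r); congr (_ *: _); ring.
Qed.

End EqualNorms.
End Ambient.

Theorem theorem5p2 (K : realType) (d : nat) (hd : (1 <= d)%N)
    (R : {fset 'cV[K]_d.+1})
    (unitR : forall r, r \in R -> enorm r = 1)
    (symR : centrally_symmetric R)
    (normR : forall S T : {fset 'cV[K]_d.+1}, semi_star R S -> semi_star R T ->
      semi_star_norm S = semi_star_norm T) :
  root_system R.
Proof. exact: equal_norms_root_system. Qed.
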